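(* Let $k\ge 2$. There is a function $f$ assigning to each $k$-tree $T$ an integer $f(T)\le 2^k+k-1$ such that for every $k$-tree $T$ on $n\ge k$ vertices there is a $k$-graph $H$ on $n$ vertices which does not contain $T$ as a subgraph and satisfies $\delta_{k-1}(H)\ge\lfloor n/2\rfloor-f(T)$. Moreover, there are $k$-trees $T$ with $f(T)=k-1$.
   Context: A $k$-graph is a (finite) $k$-uniform hypergraph. The minimum codegree $\delta_{k-1}(H)$ of a $k$-graph $H$ is the largest number $m$ such that every set of $k-1$ vertices of $H$ is contained in at least $m$ edges of $H$. A (tight) $k$-tree is a $k$-graph defined iteratively: a single $k$-uniform edge (on its $k$ vertices) is a $k$-tree; any $k$-graph obtained from a $k$-tree $T$ by adding a new vertex $v$ and a new edge $e$ such that $v\in e$ and $|e\cap e'|=k-1$ for some edge $e'\in E(T)$ is also a $k$-tree. *)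

(* Defs.v *)
From mathcomp Require Import all_boot all_order all_algebra.

Set Implicit Arguments.
Unset Strict Implicit.
Unset Printing Implicit Defensive.

Record kgraph (k : nat) (V : finType) := KGraph {
  edges : {set {set V}};
  edges_uniform : forall e : {set V}, e \in edges -> #|e| = k
}.

Definition codegree k (V : finType) (H : kgraph k V) (S : {set V}) : nat :=
  #|[set e in edges H | S \subset e]|.

(* The largest m such that every (k-1)-set lies in at least m edges.  Bounding
   m by the number of edges loses nothing as soon as some (k-1)-set exists,
   that is, when k.-1 <= #|V|. *)
Definition min_codegree k (V : finType) (H : kgraph k V) : nat :=
  \max_(m < #|edges H|.+1
        | [forall S : {set V}, (#|S| == k.-1) ==> (m <= codegree H S)]) m.

(* [tight_tree k A E]: the k-graph with vertex set A and edge set E, where A is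
   a set of vertices of the ambient type V, is a tight k-tree. *)
Inductive tight_tree (k : nat) (V : finType) :
    {set V} -> {set {set V}} -> Prop :=
| tight_tree_edge (e : {set V}) of #|e| = k : tight_tree k e [set e]
| tight_tree_add (A : {set V}) (E : {set {set V}}) (v : V) (e e' : {set V}) of
    tight_tree k A E &
    v \notin A & e \subset v |: A & #|e| = k & v \in e &
    e' \in E & #|e :&: e'| = k.-1 :
    tight_tree k (v |: A) (e |: E).

Record ktree (k : nat) := KTree {
  ktree_vertex : finType;
  ktree_graph : kgraph k ktree_vertex;
  ktreeP : tight_tree k [set: ktree_vertex] (edges ktree_graph)
}.

(* H contains a (not necessarily induced) copy of G. *)
Definition contains k (V W : finType) (H : kgraph k W) (G : kgraph k V) : Prop :=
  exists phi : V -> W,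
    injective phi /\ forall e : {set V}, e \in edges G -> phi @: e \in edges H.

(* Main.v *)
(** Let [X] be a set of vertices of [W] and let [H] consist of the [k]-sets
    meeting [X] in an odd number of points.  A [(k-1)]-set extends to an edge by
    any outside vertex of one of [X] and its complement, so the codegree is at
    least [min(|X|, |W| - |X|) - (k-1)].  A tight tree has a [k]-colouring that is
    rainbow on every edge, and two edges of the tree sharing [k-1] vertices meet
    the preimage of [X] with the same parity, so in any copy of the tree in [H]
    each colour class lies inside [X] or misses [X].  For a spanning copy [|X|] is
    thus one of the [2^k] sums of sizes of colour classes, and among the [2^k + 1]
    integers just below [n/2] one is not such a sum. *)

Require Import Defs.
From mathcomp Require Import all_boot all_order all_algebra.
From mathcomp Require Import zify.
Import Order.TTheory GRing.Theory Num.Theory.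

Set Implicit Arguments.
Unset Strict Implicit.
Unset Printing Implicit Defensive.

Lemma exists_set_card (V : finType) (a : nat) :
  a <= #|V| -> exists X : {set V}, #|X| = a.
Proof.
move=> le_a; exists [set x in take a (enum V)].
rewrite cardsE; move/card_uniqP: (take_uniq a (enum_uniq V)) => ->.
by rewrite size_takel // -cardE.
Qed.

Lemma leq_min_codegree k (V : finType) (H : kgraph k V) (m : nat) :
  k.-1 <= #|V| -> (forall S : {set V}, #|S| = k.-1 -> m <= codegree H S) ->
  m <= min_codegree H.
Proof.
move=> /exists_set_card [S0 cS0] le_m.
(* One [(k-1)]-set brings [m] into the index range of the maximum: its codegree bounds [m] and is at
   most the number of edges. *)
have lt_m : m < #|edges H|.+1.
  rewrite ltnS (leq_trans (le_m _ cS0)) // subset_leq_card //.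
  by apply/subsetP => e; rewrite inE => /andP[].
have Pm : [forall S : {set V}, (#|S| == k.-1) ==> (m <= codegree H S)].
  by apply/forallP => S; apply/implyP => /eqP /le_m.
rewrite /min_codegree (bigD1 (Ordinal lt_m)) //=.
exact: leq_maxl.
Qed.

Section OddGraph.

Variables (k : nat) (V : finType) (X : {set V}).
Hypothesis k_gt0 : 0 < k.

Definition odd_edges := [set e : {set V} | (#|e| == k) && odd #|e :&: X|].

Fact odd_edges_uniform (e : {set V}) : e \in odd_edges -> #|e| = k.
Proof. by rewrite inE => /andP[/eqP]. Qed.

Definition odd_kgraph := KGraph odd_edges_uniform.

Lemma odd_kgraph_codegree (S : {set V}) :
  #|S| = k.-1 -> minn #|X| #|~: X| - k.-1 <= codegree odd_kgraph S.
Proof.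
(* [Y] is the side whose points outside [S] extend [S] to a set meeting [X] oddly. *)
move=> cS; pose Y := if odd #|S :&: X| then ~: X else X.
have inY w : w \in Y = (w \in X) (+) odd #|S :&: X|.
  by rewrite /Y; case: (odd _); rewrite ?inE ?addbT ?addbF.
have leY : minn #|X| #|~: X| - k.-1 <= #|Y :\: S|.
  rewrite cardsD leq_sub //; first by rewrite /Y; case: ifP; rewrite ?geq_minl ?geq_minr.
  by rewrite -cS subset_leq_card // subsetIr.
apply: leq_trans leY _.
have inj : {in Y :\: S &, injective (fun w => w |: S)}.
  move=> w w' /setDP[_ wS] _ /= eqS.
  have : w \in w' |: S by rewrite -eqS setU11.
  by rewrite in_setU1 (negbTE wS) orbF => /eqP.
rewrite -(card_in_imset inj); apply: subset_leq_card; apply/subsetP => e.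
case/imsetP => w /setDP[wY wS] ->; rewrite !inE subsetUr andbT.
rewrite cardsU1 wS cS add1n prednK // eqxx /=.
rewrite setIUl; have [wX|wX] := boolP (w \in X).
  rewrite (setIidPl _) ?sub1set // cardsU1 inE (negbTE wS) /= oddD.
  by move: wY; rewrite inY wX.
rewrite (_ : [set w] :&: X = set0) ?set0U; last first.
  by apply/eqP; rewrite setI_eq0 disjoints1.
by move: wY; rewrite inY (negbTE wX).
Qed.

End OddGraph.

Lemma tight_tree_neq0 k (V : finType) (A : {set V}) (E : {set {set V}}) :
  tight_tree k A E -> exists e, e \in E.
Proof. by case=> [e _|*]; [exists e; apply: set11 | eexists; apply: setU11]. Qed.

Lemma setD1_of_card_setI (T : finType) (e e' : {set T}) (v : T) :
  v \in e -> v \notin e' -> #|e :&: e'| = #|e|.-1 -> e :&: e' = e :\ v.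
Proof.
move=> ve ve' cI; apply/eqP; rewrite eqEcard; apply/andP; split; last first.
  by rewrite cI [#|e|](cardsD1 v) ve.
apply/subsetP => x /setIP[xe xe']; rewrite !inE xe andbT.
by apply: contraNneq ve' => <-.
Qed.

(* [P] stands for the preimage of [X] under an embedding of the tree into
   [odd_kgraph k X], and [B] for the set of colours whose classes lie in [P]. *)
Lemma tight_tree_colouring k (V : finType) (A : {set V}) (E : {set {set V}}) :
  0 < k -> tight_tree k A E ->
  exists c : V -> 'I_k,
    (forall e, e \in E -> [/\ #|e| = k, e \subset A & {in e &, injective c}]) /\
    (forall (P : {set V}) (b : bool),
       (forall e, e \in E -> odd #|e :&: P| = b) ->
       exists B : {set 'I_k}, {in A, forall v, (v \in P) = (c v \in B)}).
Proof.
case: k => // k _; elim=> {A E} [e ce|A E v e e' _ [c [rainbow mono]] vA eA ce ve e'E cI].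
  have inj : {in e &, injective (fun v => inord (index v (enum e)) : 'I_k.+1)}.
    move=> x y xe ye /(congr1 val); rewrite /= !inordK -?ce ?cardE ?index_mem ?mem_enum //.
    by apply: (index_inj x); rewrite mem_enum.
  exists (fun v => inord (index v (enum e))); split=> [e1 /set1P ->|P b _] //.
  (* Each colour occurs exactly once on [e], so the colours seen on [e :&: P] determine it. *)
  exists [set inord (index v (enum e)) | v in e :&: P] => v ve.
  apply/idP/imsetP => [vP|[w /setIP[we wP] /(inj _ _ ve we) ->]] //.
  by exists v; rewrite // inE ve.
have [ce' e'A inj'] := rainbow e' e'E.
have ve' : v \notin e' by apply: contra vA; apply/subsetP.
have ev : e :&: e' = e :\ v by apply: setD1_of_card_setI; rewrite ?ce.
have neq (x : V) : x \in A -> x != v by move=> xA; apply: contraNneq vA => <-.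
(* [v'] is the vertex of [e'] that [e] trades for [v]; if [e'] lay inside [e], the two would share
   too many points. *)
have [v' v'e' v'e] : exists2 v', v' \in e' & v' \notin e.
  apply/subsetPn; apply/negP => /setIidPr e'e.
  by move: cI; rewrite e'e ce' => /eqP; rewrite -[_ == _]/(k.+1 == k) eqn_leq ltnn.
have ev' : e :&: e' = e' :\ v'.
  by rewrite setIC; apply: setD1_of_card_setI; rewrite // setIC ce'.
have v'A : v' \in A by apply: subsetP v'e'.
(* The new vertex takes the colour of [v'], the only one absent from [e :&: e'], which keeps [e]
   rainbow. *)
exists (fun x => if x == v then c v' else c x); split=> [e1|P b odd_b].
  case/setU1P => [->|/rainbow[ce1 e1A inj1]]; last first.
    split=> //; first by rewrite (subset_trans e1A) ?subsetUr.
    by move=> x y xe ye; rewrite !ifN ?neq ?(subsetP e1A) //; apply: inj1.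
  have old x : x \in e -> x != v -> (x \in e') && (x != v').
    move=> xe xv; have : x \in e' :\ v' by rewrite -ev' ev !inE xv.
    by rewrite !inE andbC.
  split=> // x y xe ye; case: eqVneq => [->|xv]; case: eqVneq => [->|yv] //.
  - by have /andP[ye' yv'] := old y ye yv; move/(inj' _ _ v'e' ye') => yE; rewrite yE eqxx in yv'.
  - by have /andP[xe' xv'] := old x xe xv; move/(inj' _ _ xe' v'e') => xE; rewrite xE eqxx in xv'.
  - have /andP[xe' _] := old x xe xv; have /andP[ye' _] := old y ye yv.
    exact: inj'.
have [e1 e1E|B defB] := mono P b; first by apply: odd_b; rewrite inE e1E orbT.
(* The same [B] works: [e] and [e'] meet [P] with equal parity and differ only in [v] and [v'], so
   [P] contains both or neither. *)
exists B => x /setU1P[->|xA]; last by rewrite ifN ?neq ?defB.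
rewrite eqxx -defB //.
have card_meet (u : V) (f : {set V}) : u \in f -> #|f :&: P| = (u \in P) + #|(f :\ u) :&: P|.
  by move=> uf; rewrite (cardsD1 u) inE uf setIDAC.
have : odd #|e :&: P| = odd #|e' :&: P| by rewrite !odd_b ?setU11 // inE e'E orbT.
rewrite (card_meet v) // (card_meet v' e') // -ev -ev' !oddD !oddb.
exact: addIb.
Qed.

(** The colouring is chosen before [X], so a single list of [2 ^ k] sizes serves all [X]. Equal
    cardinalities make the embedding bijective, hence [X] is as large as its preimage, a union of
    colour classes. *)
Lemma spanning_tree_in_odd_kgraph k (T : ktree k) (W : finType) :
  0 < k -> #|ktree_vertex T| = #|W| ->
  exists c : ktree_vertex T -> 'I_k, forall X : {set W},
    contains (odd_kgraph k X) (ktree_graph T) ->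
    exists B : {set 'I_k}, #|X| = #|c @^-1: B|.
Proof.
move=> k_gt0 cW; have [c [_ mono]] := tight_tree_colouring k_gt0 (ktreeP T).
exists c => X [phi [inj_phi phiE]].
have [e eE|B defB] := mono (phi @^-1: X) true.
  have := phiE e eE; rewrite inE => /andP[_].
  rewrite -(card_imset _ inj_phi) => <-; congr (odd _); apply: eq_card => w.
  apply/imsetP/setIP => [[v /setIP[ve]]|[/imsetP[v ve ->] wX]].
    by rewrite inE => vX ->; rewrite imset_f.
  by exists v; rewrite // !inE ve.
exists B; have -> : c @^-1: B = phi @^-1: X by apply/setP => v; rewrite [RHS]defB ?inE.
rewrite on_card_preimset //.
by apply: onW_bij; apply: inj_card_bij; rewrite ?cW.
Qed.

(** Pigeonhole: [#|I| <= N] keeps the [#|I| + 1] values [N - j] distinct under truncated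
    subtraction, too many for [g] to hit them all. *)
Lemma exists_avoided (I : finType) (g : I -> nat) (N : nat) :
  #|I| <= N -> exists j, j <= #|I| /\ forall i, g i != N - j.
Proof.
move=> leN; case: (pickP (fun j : 'I_#|I|.+1 => [forall i, g i != N - j])) => [j /forallP|hit].
  by exists (j : nat); rewrite -ltnS.
have {}hit (j : 'I_#|I|.+1) : exists i, g i == N - j.
  by apply/existsP; rewrite -[X in is_true X]negbK negb_exists hit.
have /leq_card : injective (fun j => xchoose (hit j)).
  move=> j1 j2 eq12; apply: ord_inj.
  have := eqP (xchooseP (hit j1)); rewrite eq12 (eqP (xchooseP (hit j2))).
  by have := ltn_ord j1; have := ltn_ord j2; lia.
by rewrite cardT size_enum_ord ltnn.
Qed.

Lemma empty_uniform k (V : finType) (e : {set V}) : e \in set0 -> #|e| = k.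
Proof. by rewrite inE. Qed.

Definition empty_kgraph k (V : finType) := KGraph (@empty_uniform k V).

Lemma empty_kgraph_free k (W : finType) (T : ktree k) :
  ~ contains (empty_kgraph k W) (ktree_graph T).
Proof.
have [e eE] := tight_tree_neq0 (ktreeP T).
by move=> [phi [_ /(_ e eE)]]; rewrite inE.
Qed.

Lemma full_edge_uniform k (e : {set 'I_k}) : e \in [set setT] -> #|e| = k.
Proof. by move/set1P->; rewrite cardsT card_ord. Qed.

Fact full_edge_tree k :
  tight_tree k [set: 'I_k] (edges (KGraph (@full_edge_uniform k))).
Proof. by apply: tight_tree_edge; rewrite cardsT card_ord. Qed.

Definition edge_ktree k : ktree k := KTree (@full_edge_tree k).

Lemma exists_ktree_free_kgraph k (T : ktree k) :
  0 < k -> k.-1 <= #|ktree_vertex T| ->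
  exists (W : finType) (H : kgraph k W),
    [/\ #|W| = #|ktree_vertex T|, ~ contains H (ktree_graph T)
      & (#|ktree_vertex T|)./2 - (2 ^ k + k.-1) <= min_codegree H].
Proof.
set V := ktree_vertex T => k_gt0 le_k.
have [small|large] := leqP (#|V|./2) (2 ^ k + k.-1).
  (* The truncated difference is 0 here, so any graph free of the tree serves. *)
  exists V, (empty_kgraph k V); split=> //; first exact: empty_kgraph_free.
  by rewrite (eqP small).
have [c cP] := spanning_tree_in_odd_kgraph k_gt0 (erefl #|V|).
have cB : #|{set 'I_k}| = 2 ^ k by rewrite -cardsT -powersetT card_powerset cardsT card_ord.
have [|j [lej avoid]] := @exists_avoided _ (fun B : {set 'I_k} => #|c @^-1: B|) #|V|./2.
  by rewrite cB; lia.
rewrite cB in lej.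
have [|X cX] := @exists_set_card V (#|V|./2 - j); first by lia.
exists V, (odd_kgraph k X); split=> //.
  by case/cP => B /eqP; rewrite cX eq_sym (negbTE (avoid B)).
apply: leq_min_codegree => // S cS; apply: leq_trans (odd_kgraph_codegree X k_gt0 cS).
(* [X] is no larger than its complement, and the shift [j] costs at most [2 ^ k]. *)
have := cardsC X; rewrite cX; lia.
Qed.

Local Open Scope ring_scope.

Theorem proposition1p3 (k : nat) (hk : (2 <= k)%N) :
  exists f : ktree k -> int,
    (forall T : ktree k, f T <= 2 ^+ k + k%:Z - 1) /\
    (forall (n : nat) (T : ktree k), (k <= n)%N -> #|ktree_vertex T| = n ->
       exists (W : finType) (H : kgraph k W),
         #|W| = n /\
         ~ contains H (ktree_graph T) /\
         (n./2)%:Z - f T <= (min_codegree H)%:Z) /\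
    (exists T : ktree k, f T = k%:Z - 1).
Proof.
have k_gt0 : (0 < k)%N by apply: ltnW.
have two_k : (2 ^ k)%N%:Z = 2 ^+ k by rewrite -natrX natz.
(* A tree on [k] vertices may get [k - 1]: since [k./2 <= k - 1], the empty graph serves. *)
exists (fun T => if #|ktree_vertex T| == k then k%:Z - 1 else 2 ^+ k + k%:Z - 1).
split=> [T|]; first by rewrite -two_k; case: ifP => _; lia.
split=> [n T le_kn cV|]; last by exists (edge_ktree k); rewrite card_ord eqxx.
rewrite cV; case: eqP => [->|_].
  exists 'I_k, (empty_kgraph k 'I_k); rewrite card_ord; split=> //.
  by split; [exact: empty_kgraph_free | lia].
have [|W [H [cW noT]]] := exists_ktree_free_kgraph (T := T) k_gt0; first by rewrite cV; lia.
rewrite cV in cW * => le_deg; exists W, H; split=> //; split=> //.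
rewrite -two_k; lia.
Qed.
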